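(* Let $\mathbf{V}$ be a variety of interior algebras which is a locally finite $^*$-variety. Then $t(\mathbf{V}) = t(\gamma(\mathbf{V}))$, where $\gamma(\mathbf{V}) = \{B^\circ : B\in\mathbf{V}\}$.
   Context: An interior algebra $\langle B,g\rangle$ is a Boolean algebra with an operator $g$ satisfying $g(1)=1$, $g(x\cdot y)=g(x)\cdot g(y)$, $g(x)\le x$, $g(g(x))=g(x)$; $a$ is open if $g(a)=a$. $B^\circ$ is the Heyting algebra of open elements with $a\Rightarrow b = g(-a+b)$; $\gamma(\mathbf{V})$ is a variety of Heyting algebras. $B$ is a $^*$-algebra if it is generated (as an interior algebra) by its open elements; $\mathbf{V}^*$ is the variety generated by the $^*$-algebras in $\mathbf{V}$, and $\mathbf{V}$ is a $^*$-variety if $\mathbf{V}=\mathbf{V}^*$. Unification: for a variety $\mathbf{W}$ and finitely presented $A\in\mathbf{W}$, a unifier is a pair $\langle u,B\rangle$ with $B$ finitely presented and projective in $\mathbf{W}$ and $u\colon A\to B$ a homomorphism; $A$ is unifiable if it has one. Unifiers are quasiordered by $\langle u,B\rangle\succcurlyeq\langle v,C\rangle$ iff $v=h\circ u$ for some homomorphism $h\colon B\to C$. The type of $A$ is $1$, $\omega$, $\infty$ according as this quasiordered set has a dense antichain ($\mu$-set) of cardinality $1$, finite $>1$, or infinite, and $0$ if it has none. The type $t(\mathbf{W})$ is unitary if every unifiable algebra has type $1$; finitary if all have type $1$ or $\omega$ and some has $\omega$; infinitary if all have type $1,\omega,\infty$ and some has $\infty$; nullary if some has type $0$. *)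

(* Defs.v *)
From mathcomp Require Import ssreflect ssrfun ssrbool eqtype ssrnat fintype.

Set Implicit Arguments.
Unset Strict Implicit.
Unset Printing Implicit Defensive.

Record sig := Sig { op : Type; arity : op -> nat }.

Record alg (S : sig) := Alg {
  carrier :> Type;
  interp : forall o : op S, ('I_(arity o) -> carrier) -> carrier }.
Arguments interp {S} a o _ : rename.

Inductive term (S : sig) (X : Type) : Type :=
  | Var : X -> term S X
  | App : forall o : op S, ('I_(arity o) -> term S X) -> term S X.
Arguments Var {S X} _.
Arguments App {S X} o _.

Fixpoint eval (S : sig) (A : alg S) (X : Type) (v : X -> A) (t : term S X) : A :=
  match t with
  | Var x => v x
  | App o ts => interp A o (fun i => eval v (ts i))
  end.

Definition equation (S : sig) := (term S nat * term S nat)%type.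
Definition sat (S : sig) (A : alg S) (e : equation S) : Prop :=
  forall v : nat -> A, eval v e.1 = eval v e.2.

Definition hom (S : sig) (A B : alg S) (h : A -> B) : Prop :=
  forall (o : op S) (args : 'I_(arity o) -> A),
    h (interp A o args) = interp B o (fun i => h (args i)).

Definition generates (S : sig) (A : alg S) (n : nat) (a : 'I_n -> A) : Prop :=
  forall x : A, exists t : term S 'I_n, eval a t = x.

Definition finite_carrier (S : sig) (A : alg S) : Prop :=
  exists m (e : 'I_m -> A), forall x : A, exists i, e i = x.

Definition locally_finite (S : sig) (K : alg S -> Prop) : Prop :=
  forall A : alg S, K A ->
    forall n (a : 'I_n -> A), generates a -> finite_carrier A.

(* A is finitely presented in K: A in K has a finite presentation
   <a_1..a_n | E> with E finite, i.e. a generates A, a satisfies E, and for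
   every C in K and every tuple c of C satisfying E there is a homomorphism
   A -> C sending a to c (so A is the K-free algebra on n generators modulo
   the congruence generated by E). *)
Definition fin_pres (S : sig) (K : alg S -> Prop) (A : alg S) : Prop :=
  K A /\
  exists n (a : 'I_n -> A) m (E : 'I_m -> (term S 'I_n * term S 'I_n)%type),
    generates a /\
    (forall j, eval a (E j).1 = eval a (E j).2) /\
    (forall (C : alg S), K C -> forall c : 'I_n -> C,
        (forall j, eval c (E j).1 = eval c (E j).2) ->
        exists h : A -> C, hom h /\ forall i, h (a i) = c i).

Definition projective (S : sig) (K : alg S -> Prop) (B : alg S) : Prop :=
  K B /\
  forall (C D : alg S), K C -> K D ->
  forall (p : C -> D), hom p -> (forall d, exists c, p c = d) ->
  forall (f : B -> D), hom f ->
  exists g : B -> C, hom g /\ forall x, p (g x) = f x.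

Record unifier (S : sig) (K : alg S -> Prop) (A : alg S) := Unifier {
  ucod : alg S;
  umap : A -> ucod;
  uhom : hom umap;
  ufp : fin_pres K ucod;
  uproj : projective K ucod }.
Arguments ucod {S K A} u.
Arguments umap {S K A} u _.

Definition more_general (S : sig) (K : alg S -> Prop) (A : alg S)
    (u v : unifier K A) : Prop :=
  exists h : ucod u -> ucod v, hom h /\ forall x, umap v x = h (umap u x).

Definition unifiable (S : sig) (K : alg S -> Prop) (A : alg S) : Prop :=
  exists u : unifier K A, True.

Definition mu_set (S : sig) (K : alg S -> Prop) (A : alg S)
    (I : Type) (f : I -> unifier K A) : Prop :=
  (forall i j, more_general (f i) (f j) -> i = j) /\
  (forall v : unifier K A, exists i, more_general (f i) v).

Definition finite_type (I : Type) : Prop :=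
  exists n (e : 'I_n -> I), forall i, exists k, e k = i.

Definition type1 (S : sig) (K : alg S -> Prop) (A : alg S) : Prop :=
  exists (I : Type) (f : I -> unifier K A), mu_set f /\
    exists i0 : I, forall i, i = i0.
Definition typeomega (S : sig) (K : alg S -> Prop) (A : alg S) : Prop :=
  exists (I : Type) (f : I -> unifier K A), mu_set f /\
    finite_type I /\ exists i j : I, i <> j.
Definition typeinf (S : sig) (K : alg S -> Prop) (A : alg S) : Prop :=
  exists (I : Type) (f : I -> unifier K A), mu_set f /\ ~ finite_type I.
Definition type0 (S : sig) (K : alg S -> Prop) (A : alg S) : Prop :=
  ~ exists (I : Type) (f : I -> unifier K A), mu_set f.

Inductive utype := Unitary | Finitary | Infinitary | Nullary.

Definition var_type (S : sig) (K : alg S -> Prop) (t : utype) : Prop :=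
  let P := fun A : alg S => fin_pres K A /\ unifiable K A in
  match t with
  | Unitary => forall A, P A -> type1 K A
  | Finitary => (forall A, P A -> type1 K A \/ typeomega K A) /\
                exists A, P A /\ typeomega K A
  | Infinitary => (forall A, P A -> type1 K A \/ typeomega K A \/ typeinf K A) /\
                  exists A, P A /\ typeinf K A
  | Nullary => exists A, P A /\ type0 K A
  end.

Inductive ia_op := IA0 | IA1 | IAjoin | IAmeet | IAcompl | IAint.
Definition ia_arity (o : ia_op) : nat :=
  match o with IA0 | IA1 => 0 | IAjoin | IAmeet => 2 | IAcompl | IAint => 1 end.
Definition IASig : sig := @Sig ia_op ia_arity.

Definition args0 (T : Type) : 'I_0 -> T.
Proof. by case. Defined.
Definition args1 (T : Type) (x : T) : 'I_1 -> T := fun _ => x.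
Definition args2 (T : Type) (x y : T) : 'I_2 -> T :=
  fun i => if nat_of_ord i == 0 then x else y.

Section IAops.
Variable A : alg IASig.
Definition izero : A := interp A IA0 (@args0 A).
Definition ione : A := interp A IA1 (@args0 A).
Definition ijoin (x y : A) : A := interp A IAjoin (args2 x y).
Definition imeet (x y : A) : A := interp A IAmeet (args2 x y).
Definition icompl (x : A) : A := interp A IAcompl (args1 x).
Definition iint (x : A) : A := interp A IAint (args1 x).
End IAops.

(* Boolean algebra (Huntington's postulates) with an interior operator g *)
Definition is_ia (A : alg IASig) : Prop :=
  (forall x y : A, ijoin x y = ijoin y x) /\
  (forall x y : A, imeet x y = imeet y x) /\
  (forall x : A, ijoin x (izero A) = x) /\
  (forall x : A, imeet x (ione A) = x) /\
  (forall x y z : A, ijoin x (imeet y z) = imeet (ijoin x y) (ijoin x z)) /\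
  (forall x y z : A, imeet x (ijoin y z) = ijoin (imeet x y) (imeet x z)) /\
  (forall x : A, ijoin x (icompl x) = ione A) /\
  (forall x : A, imeet x (icompl x) = izero A) /\
  iint (ione A) = ione A /\
  (forall x y : A, iint (imeet x y) = imeet (iint x) (iint y)) /\
  (forall x : A, imeet (iint x) x = iint x) (* g(x) <= x *) /\
  (forall x : A, iint (iint x) = iint x).

Definition ia_variety (V : alg IASig -> Prop) : Prop :=
  exists E : equation IASig -> Prop,
    forall A, V A <-> (is_ia A /\ forall e, E e -> sat A e).

Definition is_open (A : alg IASig) (a : A) : Prop := iint a = a.

Definition star_alg (B : alg IASig) : Prop :=
  forall b : B, exists (v : nat -> B) (t : term IASig nat),
    (forall k, is_open (v k)) /\ eval v t = b.

(* V^* : the variety generated by the *-algebras in V *)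
Definition vstar (V : alg IASig -> Prop) (A : alg IASig) : Prop :=
  forall e : equation IASig,
    (forall B, V B -> star_alg B -> sat B e) -> sat A e.

Definition star_variety (V : alg IASig -> Prop) : Prop :=
  forall A, V A <-> vstar V A.

Inductive h_op := H0 | H1 | Hmeet | Hjoin | Himp.
Definition h_arity (o : h_op) : nat :=
  match o with H0 | H1 => 0 | Hmeet | Hjoin | Himp => 2 end.
Definition HSig : sig := @Sig h_op h_arity.

Definition open_op (B : alg IASig) (o : h_op) : ('I_(h_arity o) -> B) -> B :=
  match o return ('I_(h_arity o) -> B) -> B with
  | H0 => fun _ => izero B
  | H1 => fun _ => ione B
  | Hmeet => fun a => imeet (a (@ord0 1)) (a (@ord_max 1))
  | Hjoin => fun a => ijoin (a (@ord0 1)) (a (@ord_max 1))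
  | Himp => fun a => iint (ijoin (icompl (a (@ord0 1))) (a (@ord_max 1)))
  end.

(* H is isomorphic to B° (the Heyting algebra of open elements of B,
   with a => b = g(-a + b)) *)
Definition iso_open (H : alg HSig) (B : alg IASig) : Prop :=
  exists phi : H -> B,
    (forall x y, phi x = phi y -> x = y) /\
    (forall b : B, is_open b <-> exists x, phi x = b) /\
    (forall (o : h_op) (args : 'I_(h_arity o) -> H),
        phi (interp H o args) = @open_op B o (fun i => phi (args i))).

Definition gamma (V : alg IASig -> Prop) (H : alg HSig) : Prop :=
  exists B, V B /\ iso_open H B.

(* Main.v *)
Require Import Defs.
From mathcomp Require Import ssreflect ssrfun ssrbool eqtype ssrnat seq choice fintype finfun.
From Stdlib Require Import ClassicalEpsilon FunctionalExtensionality ProofIrrelevance.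

(** Write [c] for the closure operator [- g -]. An element of a star algebra is
    a Boolean combination of open elements, and from this star algebras satisfy
    the Grzegorczyk law [x <= c(x - c(c x - x))]; as [V = V^*], so does [V].
    In a finite algebra satisfying this law, iterating
    [x |-> x . c(c x - x)] reaches [0], which exhibits [x] as a Boolean
    combination of open elements. So the finite, that is, the finitely presented,
    algebras of [V] are star algebras. A Heyting homomorphism from [B°] to [C°]
    extends uniquely to [B -> C] when [B] is a star algebra, whence [B |-> B°] is
    an equivalence between the finite algebras of [V] and those of [gamma V].
    It preserves and reflects projectivity, so it induces equivalences between
    the quasiorders of unifiers, and these carry mu-sets to mu-sets. *)

Set Implicit Arguments.
Unset Strict Implicit.
Unset Printing Implicit Defensive.

(** * Boolean reasoning in interior algebras *)

Section BooleanLaws.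
Variable A : alg IASig.
Hypothesis hA : is_ia A.
Implicit Types x y z : A.

Lemma ijoinC x y : ijoin x y = ijoin y x.
Proof. by case: hA => h _; apply: h. Qed.
Lemma imeetC x y : imeet x y = imeet y x.
Proof. by case: hA => _ [h _]; apply: h. Qed.
Lemma ijoin0 x : ijoin x (izero A) = x.
Proof. by case: hA => _ [_ [h _]]; apply: h. Qed.
Lemma imeet1 x : imeet x (ione A) = x.
Proof. by case: hA => _ [_ [_ [h _]]]; apply: h. Qed.
Lemma ijoinIr x y z : ijoin x (imeet y z) = imeet (ijoin x y) (ijoin x z).
Proof. by case: hA => _ [_ [_ [_ [h _]]]]; apply: h. Qed.
Lemma imeetUr x y z : imeet x (ijoin y z) = ijoin (imeet x y) (imeet x z).
Proof. by case: hA => _ [_ [_ [_ [_ [h _]]]]]; apply: h. Qed.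
Lemma ijoinN x : ijoin x (icompl x) = ione A.
Proof. by case: hA => _ [_ [_ [_ [_ [_ [h _]]]]]]; apply: h. Qed.
Lemma imeetN x : imeet x (icompl x) = izero A.
Proof. by case: hA => _ [_ [_ [_ [_ [_ [_ [h _]]]]]]]; apply: h. Qed.
Lemma iint1 : iint (ione A) = ione A.
Proof. by case: hA => _ [_ [_ [_ [_ [_ [_ [_ [h _]]]]]]]]; apply: h. Qed.
Lemma iintI x y : iint (imeet x y) = imeet (iint x) (iint y).
Proof. by case: hA => _ [_ [_ [_ [_ [_ [_ [_ [_ [h _]]]]]]]]]; apply: h. Qed.
Lemma iint_le x : imeet (iint x) x = iint x.
Proof. by case: hA => _ [_ [_ [_ [_ [_ [_ [_ [_ [_ [h _]]]]]]]]]]; apply: h. Qed.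
Lemma iintK x : iint (iint x) = iint x.
Proof. by case: hA => _ [_ [_ [_ [_ [_ [_ [_ [_ [_ [_ h]]]]]]]]]]; apply: h. Qed.

Lemma imeetxx x : imeet x x = x.
Proof. by rewrite -{3}(imeet1 x) -(ijoinN x) imeetUr imeetN ijoin0. Qed.
Lemma imeet0 x : imeet x (izero A) = izero A.
Proof.
by rewrite -(ijoin0 (imeet x _)) -{2}(imeetN x) -imeetUr ijoinC ijoin0 imeetN.
Qed.
Lemma ijoin1 x : ijoin x (ione A) = ione A.
Proof.
by rewrite -(imeet1 (ijoin x _)) -{2}(ijoinN x) -ijoinIr imeetC imeet1 ijoinN.
Qed.
Lemma ijoinKI x y : ijoin x (imeet x y) = x.
Proof. by rewrite -{1}(imeet1 x) -imeetUr ijoinC ijoin1 imeet1. Qed.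
Lemma imeetKU x y : imeet x (ijoin x y) = x.
Proof. by rewrite -{1}(ijoin0 x) -ijoinIr imeetC imeet0 ijoin0. Qed.

Lemma eq_by_joins x y z :
  ijoin z x = ijoin z y -> ijoin (icompl z) x = ijoin (icompl z) y -> x = y.
Proof.
have splitE w : w = imeet (ijoin z w) (ijoin (icompl z) w).
  by rewrite !(ijoinC _ w) -ijoinIr imeetN ijoin0.
by move=> e1 e2; rewrite (splitE x) (splitE y) e1 e2.
Qed.

(** Huntington's postulates omit associativity. Joined with [x], both sides become [x] by
    absorption; joined with [icompl x], the factor [x] cancels. *)
Lemma imeetA x y z : imeet x (imeet y z) = imeet (imeet x y) z.
Proof.
apply: (@eq_by_joins _ _ x); rewrite !ijoinIr.
  have -> : ijoin x x = x by rewrite -{2}(imeetxx x) ijoinKI.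
  by rewrite -ijoinIr !imeetKU.
by rewrite [ijoin _ x]ijoinC ijoinN ![imeet (ione A) _]imeetC !imeet1.
Qed.

Lemma eq_by_meets x y z :
  imeet z x = imeet z y -> imeet (icompl z) x = imeet (icompl z) y -> x = y.
Proof.
have splitE w : w = ijoin (imeet z w) (imeet (icompl z) w).
  by rewrite !(imeetC _ w) -imeetUr ijoinN imeet1.
by move=> e1 e2; rewrite (splitE x) (splitE y) e1 e2.
Qed.

End BooleanLaws.

(** * Truth tables as a decision procedure for Boolean entailments *)

Inductive bform :=
  | BVar of nat | B0 | B1
  | BJoin of bform & bform | BMeet of bform & bform | BCompl of bform.

Fixpoint bform_eval (A : alg IASig) (e : seq A) (s : bform) : A :=
  match s with
  | BVar n => nth (izero A) e n
  | B0 => izero A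
  | B1 => ione A
  | BJoin s t => ijoin (bform_eval e s) (bform_eval e t)
  | BMeet s t => imeet (bform_eval e s) (bform_eval e t)
  | BCompl s => icompl (bform_eval e s)
  end.

Fixpoint bform_bool (b : seq bool) (s : bform) : bool :=
  match s with
  | BVar n => nth false b n
  | B0 => false
  | B1 => true
  | BJoin s t => bform_bool b s || bform_bool b t
  | BMeet s t => bform_bool b s && bform_bool b t
  | BCompl s => ~~ bform_bool b s
  end.

Fixpoint bool_seqs (n : nat) : seq (seq bool) :=
  if n is m.+1 then
    [seq true :: b | b <- bool_seqs m] ++ [seq false :: b | b <- bool_seqs m]
  else [:: [::]].

Definition bform_entails (n : nat) (hs : seq (bform * bform)) (s t : bform) :=
  all (fun b => all (fun h => bform_bool b h.1 == bform_bool b h.2) hs ==>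
                (bform_bool b s == bform_bool b t)) (bool_seqs n).

Fixpoint all_hold (A : alg IASig) (e : seq A) (hs : seq (bform * bform)) : Prop :=
  if hs is h :: hs' then
    bform_eval e h.1 = bform_eval e h.2 /\ all_hold e hs'
  else True.

Section Reflection.
Variable A : alg IASig.
Hypothesis hA : is_ia A.

Fixpoint minterm (b : seq bool) (e : seq A) : A :=
  match b, e with
  | c :: b', x :: e' => imeet (if c then x else icompl x) (minterm b' e')
  | _, _ => ione A
  end.

(** A minterm behaves like an atom: it lies below the formulas that [b] makes true and misses those
    that [b] makes false. *)
Lemma minterm_eval b e s : size b = size e ->
  imeet (minterm b e) (bform_eval e s) =
  if bform_bool b s then minterm b e else izero A.
Proof.
move=> sz; elim: s => [n|||s IHs t IHt|s IHs t IHt|s IHs] /=.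
- elim: n b e sz => [|n IHn] [|c b] [|x e] //= sz; rewrite ?imeet0 //.
    rewrite [imeet _ x](imeetC hA) (imeetA hA).
    by case: c; rewrite ?imeetxx // imeetN // imeetC // imeet0.
  case: sz => /IHn; rewrite -(imeetA hA) => ->.
  by case: (nth _ _ _); rewrite ?imeet0.
- exact: imeet0.
- exact: imeet1.
- rewrite (imeetUr hA) IHs IHt.
  case: (bform_bool b s); case: (bform_bool b t) => /=; rewrite ?ijoin0 //.
    by rewrite -{2}(imeetxx hA (minterm b e)) ijoinKI.
  by rewrite ijoinC // ijoin0.
- rewrite (imeetA hA) IHs; case: (bform_bool b s) => //=.
  by rewrite imeetC // imeet0.
- case: (bform_bool b s) IHs => /= IHs.
    by rewrite -IHs -(imeetA hA) imeetN // imeet0.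
  by rewrite -{2}(imeet1 hA (minterm b e)) -(ijoinN hA (bform_eval e s))
     (imeetUr hA) IHs (ijoinC hA) ijoin0.
Qed.

Lemma size_bool_seqs n b : b \in bool_seqs n -> size b = n.
Proof.
elim: n b => [|n IHn] b /=; first by rewrite inE => /eqP ->.
by rewrite mem_cat => /orP[] /mapP[c /IHn szc ->] /=; rewrite szc.
Qed.

(** Minterms cover the unit: [eq_by_meets] splits on the head of [e]. *)
Lemma eq_by_minterms (e : seq A) x y :
  (forall b, b \in bool_seqs (size e) ->
     imeet (minterm b e) x = imeet (minterm b e) y) -> x = y.
Proof.
elim: e x y => [|z e IHe] x y /= H.
  by have := H [::] isT; rewrite ![imeet (ione A) _]imeetC // !imeet1.
apply: (@eq_by_meets A hA x y z); apply: IHe => b bin.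
  have := H (true :: b); rewrite mem_cat map_f //= => /(_ isT).
  by rewrite !(imeetA hA) [imeet _ z]imeetC.
have := H (false :: b); rewrite mem_cat (map_f (cons false)) // orbT /= => /(_ isT).
by rewrite !(imeetA hA) [imeet _ (icompl z)]imeetC.
Qed.

Lemma bform_sound (e : seq A) hs s t :
  bform_entails (size e) hs s t -> all_hold e hs ->
  bform_eval e s = bform_eval e t.
Proof.
move=> /allP ent hold; apply: (@eq_by_minterms e) => b bin.
have sz := size_bool_seqs bin.
rewrite !minterm_eval //.
have [hb|/negP hb] := boolP (all (fun h => bform_bool b h.1 == bform_bool b h.2) hs).
  by have := ent _ bin; rewrite hb => /eqP ->.
(* Some hypothesis [p = q] fails under [b]. The minterm meets the common value of [p] and [q] both
   in itself and in zero, so it is zero. *)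
suff -> : minterm b e = izero A by rewrite !if_same.
elim: hs hb {ent} hold => [|[p q] hs IHhs] //= hb [pq hold].
have [hpq|hpq] := eqVneq (bform_bool b p) (bform_bool b q).
  by apply: IHhs => // ?; apply: hb; rewrite hpq eqxx.
have := minterm_eval p sz; rewrite pq minterm_eval //.
by case: (bform_bool b p) (bform_bool b q) hpq => [] [].
Qed.

End Reflection.

Ltac ba_index x e :=
  lazymatch e with
  | cons x _ => constr:(O)
  | cons _ ?e' => let n := ba_index x e' in constr:(S n)
  end.

Ltac ba_mem x e :=
  lazymatch e with
  | cons x _ => constr:(true)
  | cons _ ?e' => ba_mem x e'
  | _ => constr:(false)
  end.

Ltac ba_atoms t e :=
  lazymatch t with
  | ijoin ?x ?y => let e1 := ba_atoms x e in ba_atoms y e1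
  | imeet ?x ?y => let e1 := ba_atoms x e in ba_atoms y e1
  | icompl ?x => ba_atoms x e
  | izero _ => e
  | ione _ => e
  | ?x => let b := ba_mem x e in
          lazymatch b with true => e | false => constr:(cons x e) end
  end.

Ltac ba_reify t e :=
  lazymatch t with
  | ijoin ?x ?y => let s := ba_reify x e in let u := ba_reify y e in constr:(BJoin s u)
  | imeet ?x ?y => let s := ba_reify x e in let u := ba_reify y e in constr:(BMeet s u)
  | icompl ?x => let s := ba_reify x e in constr:(BCompl s)
  | izero _ => constr:(B0)
  | ione _ => constr:(B1)
  | ?x => let n := ba_index x e in constr:(BVar n)
  end.

(* The goal is [p1 = q1 -> ... -> pk = qk -> s = t]; the equations are read as
   propositional formulas in their non-Boolean subterms. *)
Ltac ba_goal_atoms g e :=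
  lazymatch g with
  | ?p = ?q -> ?g' =>
      let e1 := ba_atoms p e in let e2 := ba_atoms q e1 in ba_goal_atoms g' e2
  | ?s = ?t => let e1 := ba_atoms s e in ba_atoms t e1
  end.

Ltac ba_goal_hyps g e :=
  lazymatch g with
  | ?p = ?q -> ?g' =>
      let p' := ba_reify p e in let q' := ba_reify q e in
      let hs := ba_goal_hyps g' e in constr:(cons (p', q') hs)
  | _ => constr:(@nil (bform * bform))
  end.

(** Terms such as [iint x] and a folded [icl x] are atoms here, so facts about them are first moved
    into the goal as premises. *)
Ltac ba hA :=
  let A := lazymatch type of hA with is_ia ?A => A end in
  lazymatch goal with |- ?g =>
    let e := ba_goal_atoms g (@nil (carrier A)) in
    let hs := ba_goal_hyps g e in
    intros;
    lazymatch goal with |- ?s = ?t =>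
      let s' := ba_reify s e in let t' := ba_reify t e in
      apply: (@bform_sound A hA e hs s' t');
      [vm_compute; reflexivity | repeat (split; [assumption|]); exact I]
    end
  end.

(** The order is an equation, so that inequalities can be premises and goals of [ba]. *)
Notation "x <=i y" := (imeet x y = x) (at level 70, no associativity).

(** * Open elements and closure *)

Section InteriorLaws.
Variable A : alg IASig.
Hypothesis hA : is_ia A.
Implicit Types x y z u : A.

Definition icl x := icompl (iint (icompl x)).

Lemma iint_mono x y : x <=i y -> iint x <=i iint y.
Proof. by move=> h; rewrite -iintI // h. Qed.

Lemma open_le_iint u x : is_open u -> u <=i x -> u <=i iint x.
Proof. by move=> uo /iint_mono; rewrite uo. Qed.

Lemma is_open_zero : is_open (izero A).
Proof. by have := iint_le hA (izero A); rewrite /is_open; ba hA. Qed.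

Lemma is_open_one : is_open (ione A).
Proof. exact: iint1. Qed.

Lemma is_open_int x : is_open (iint x).
Proof. exact: iintK. Qed.

Lemma is_open_meet x y : is_open x -> is_open y -> is_open (imeet x y).
Proof. by rewrite /is_open iintI // => -> ->. Qed.

Lemma is_open_join x y : is_open x -> is_open y -> is_open (ijoin x y).
Proof.
move=> xo yo.
have /(open_le_iint xo) : x <=i ijoin x y by ba hA.
have /(open_le_iint yo) : y <=i ijoin x y by ba hA.
by have := iint_le hA (ijoin x y); rewrite /is_open; ba hA.
Qed.

Lemma le_icl x : x <=i icl x.
Proof. by have := iint_le hA (icompl x); rewrite /icl; ba hA. Qed.

Lemma open_disjoint_icl u x :
  is_open u -> imeet u x = izero A -> imeet u (icl x) = izero A.
Proof.
move=> uo ux0.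
have /(open_le_iint uo) : u <=i icompl x by move: ux0; ba hA.
by rewrite /icl; ba hA.
Qed.

(** The open element [u . g(-(u . x))] misses [x], hence also the closure of [x]. *)
Lemma open_meet_icl u x : is_open u -> imeet u (icl x) <=i icl (imeet u x).
Proof.
move=> uo.
have : imeet (imeet u (iint (icompl (imeet u x)))) (icl x) = izero A.
  apply: open_disjoint_icl; first exact: is_open_meet (is_open_int _).
  by have := iint_le hA (icompl (imeet u x)); ba hA.
by rewrite /icl; ba hA.
Qed.

End InteriorLaws.

(** * Homomorphisms, subalgebras and finite presentations *)

Lemma choice_fun (I : Type) (T : I -> Type) (P : forall i, T i -> Prop) :
  (forall i, exists x, P i x) -> exists f : forall i, T i, forall i, P i (f i).
Proof.
move=> h; exists (fun i => sval (constructive_indefinite_description _ (h i))).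
by move=> i; case: constructive_indefinite_description.
Qed.

Inductive gen (S : sig) (A : alg S) (P : A -> Prop) : A -> Prop :=
  | gen_in x : P x -> gen P x
  | gen_op (o : op S) (args : 'I_(arity o) -> A) :
      (forall i, gen P (args i)) -> gen P (interp A o args).

Section UniversalAlgebra.
Variable S : sig.

Lemma hom_comp (A B C : alg S) (f : A -> B) (h : B -> C) :
  hom f -> hom h -> hom (h \o f).
Proof. by move=> fh hh o args; rewrite /= fh hh. Qed.

Lemma hom_eval (A B : alg S) (h : A -> B) (X : Type) (v : X -> A) t :
  hom h -> h (eval v t) = eval (h \o v) t.
Proof.
move=> hh; elim: t => [x|o ts IH] //=; rewrite hh; congr (interp B o _).
by apply: functional_extensionality.
Qed.

Lemma sat_inj_hom (A B : alg S) (h : A -> B) e :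
  hom h -> (forall x y, h x = h y -> x = y) -> sat B e -> sat A e.
Proof. by move=> hh hi sB v; apply: hi; rewrite !hom_eval. Qed.

Lemma gen_eq_hom (A B : alg S) (P : A -> Prop) (f h : A -> B) :
  hom f -> hom h -> (forall x, P x -> f x = h x) -> forall x, gen P x -> f x = h x.
Proof.
move=> fh hh fhP x; elim=> {x} [x /fhP //|o args _ IH]; rewrite fh hh.
by congr (interp B o _); apply: functional_extensionality.
Qed.

Fixpoint tsubst (X Y : Type) (f : X -> term S Y) (t : term S X) : term S Y :=
  match t with
  | Var x => f x
  | App o ts => App o (fun i => tsubst f (ts i))
  end.

Lemma eval_tsubst (A : alg S) (X Y : Type) (f : X -> term S Y) (v : Y -> A) t :
  eval v (tsubst f t) = eval (fun x => eval v (f x)) t.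
Proof.
elim: t => [x|o ts IH] //=; congr (interp A o _).
by apply: functional_extensionality.
Qed.

Lemma gen_eval (A : alg S) (P : A -> Prop) (X : Type) (v : X -> A) t :
  (forall x, P (v x)) -> gen P (eval v t).
Proof. by move=> Pv; elim: t => [x|o ts IH] /=; [apply: gen_in|apply: gen_op]. Qed.

Lemma eval_gen (A : alg S) (X : Type) (v : X -> A) (P : A -> Prop) x :
  (forall y, P y -> exists t, eval v t = y) -> gen P x -> exists t, eval v t = x.
Proof.
move=> Pv; elim=> {x} [x /Pv //|o args _ /choice_fun[ts tsE]].
exists (App o ts) => /=; congr (interp A o _).
by apply: functional_extensionality.
Qed.

Section Subalgebra.
Variables (A : alg S) (P : A -> Prop).

Definition gen_alg : alg S :=
  @Alg S {x : A | gen P x} (fun o args =>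
    exist _ (interp A o (fun i => sval (args i)))
      (gen_op (fun i => proj2_sig (args i)))).

Lemma gen_alg_inj (x y : gen_alg) : sval x = sval y -> x = y.
Proof.
case: x y => [x hx] [y hy] /= e; case: y / e hy => hy.
by rewrite (proof_irrelevance _ hx hy).
Qed.

Lemma hom_gen_val : hom (sval : gen_alg -> A).
Proof. by []. Qed.

(** The induction runs on a copy of the membership proof; proof irrelevance then replaces the
    original by one built from the arguments. *)
Lemma gen_alg_gen (x : gen_alg) : gen (fun y : gen_alg => P (sval y)) x.
Proof.
case: x => x hx; have {}hx' := hx.
elim: hx' hx => {x} [x Px|o args hargs IH] hx; first exact: gen_in.
have -> : exist _ _ hx = interp gen_alg o (fun i => exist _ _ (hargs i)).
  exact: gen_alg_inj.
by apply: gen_op => i; apply: IH.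
Qed.

End Subalgebra.

Hypothesis op_fin : finite_type (op S).

(** The presentation is the operation table: a generator for each index of an enumeration, an
    equation for each operation and tuple of indices. *)
Lemma finite_fin_pres (K : alg S -> Prop) (A : alg S) :
  K A -> finite_carrier A -> fin_pres K A.
Proof.
move=> KA [m [e eS]]; split=> //; have [idx idxK] := choice_fun eS.
have [k [eo eoS]] := op_fin.
pose T := ({j : 'I_k & {ffun 'I_(arity (eo j)) -> 'I_m}} + 'I_m)%type.
pose E (x : T) : term S 'I_m * term S 'I_m :=
  match x with
  | inl (existT j f) =>
      (App (eo j) (fun i => Var (f i)), Var (idx (interp A (eo j) (e \o f))))
  (* The enumeration may repeat elements; generators with the same value are identified. *)
  | inr i => (Var (idx (e i)), Var i)
  end.
exists m, e, #|{: T}|, (E \o enum_val); split; last split.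
- by move=> x; exists (Var (idx x)); apply: idxK.
- move=> j /=; case: (enum_val j) => [[o f]|i] /=; last by rewrite idxK.
  by rewrite idxK.
- move=> C KC c cE.
  have {}cE (x : T) : eval c (E x).1 = eval c (E x).2.
    by have := cE (enum_rank x); rewrite /= enum_rankK.
  exists (c \o idx); split=> [o args|i]; last exact: (cE (inr i)).
  (* Writing [o] as [eo j] gives [args] the type that the table equations are indexed by. *)
  have [j oE] := eoS o; move: args; rewrite -{o}oE => args.
  have := cE (inl (existT _ j [ffun i => idx (args i)])) => /=.
  have -> : e \o [ffun i => idx (args i)] = args.
    by apply: functional_extensionality => i; rewrite /= ffunE.
  move=> <-; congr (interp C _ _).
  by apply: functional_extensionality => i; rewrite /= ffunE.
Qed.

(** The given element of [A] is the default at indices whose entry lies outside the image of [f]. *)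
Lemma finite_carrier_inj (A : alg S) (T : Type) (f : A -> T) m (e : 'I_m -> T) :
  (forall x y, f x = f y -> x = y) -> (forall y, exists i, e i = y) ->
  A -> finite_carrier A.
Proof.
move=> fi eS a0.
have [e' e'P] : exists e' : 'I_m -> A, forall i, forall x, f x = e i -> e' i = x.
  apply: (@choice_fun _ _ (fun i y => forall x, f x = e i -> y = x)) => i.
  case: (classic (exists x, f x = e i)) => [[x fx]|nx].
    by exists x => y; rewrite -fx => /fi.
  by exists a0 => x fx; case: nx; exists x.
by exists m, e' => x; have [i ei] := eS (f x); exists i; apply: e'P.
Qed.

End UniversalAlgebra.

Lemma args0E (T : Type) (a : 'I_0 -> T) : a = @args0 T.
Proof. by apply: functional_extensionality; case. Qed.
Lemma args1E (T : Type) (a : 'I_1 -> T) : a = args1 (a ord0).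
Proof. by apply: functional_extensionality => i; rewrite [i]ord1. Qed.
Lemma args2E (T : Type) (a : 'I_2 -> T) : a = args2 (a (@ord0 1)) (a (@ord_max 1)).
Proof.
apply: functional_extensionality; case=> [[|[|n]] lt_n2] //=; rewrite /args2 /=;
  by congr a; apply: val_inj.
Qed.

Section Interp.
Variable A : alg IASig.

Lemma interpIA0 a : interp A IA0 a = izero A.
Proof. by rewrite /izero -(args0E a). Qed.
Lemma interpIA1 a : interp A IA1 a = ione A.
Proof. by rewrite /ione -(args0E a). Qed.
Lemma interpIAjoin a :
  interp A IAjoin a = ijoin (a (@ord0 1)) (a (@ord_max 1)).
Proof. by rewrite /ijoin -(args2E a). Qed.
Lemma interpIAmeet a :
  interp A IAmeet a = imeet (a (@ord0 1)) (a (@ord_max 1)).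
Proof. by rewrite /imeet -(args2E a). Qed.
Lemma interpIAcompl a : interp A IAcompl a = icompl (a ord0).
Proof. by rewrite /icompl -(args1E a). Qed.
Lemma interpIAint a : interp A IAint a = iint (a ord0).
Proof. by rewrite /iint -(args1E a). Qed.

End Interp.

Section HomLaws.
Variables (A B : alg IASig) (h : A -> B).

Lemma hom_izero : hom h -> h (izero A) = izero B.
Proof. by move=> hh; rewrite /izero hh [X in interp B _ X](args0E _). Qed.
Lemma hom_ione : hom h -> h (ione A) = ione B.
Proof. by move=> hh; rewrite /ione hh [X in interp B _ X](args0E _). Qed.
Lemma hom_ijoin x y : hom h -> h (ijoin x y) = ijoin (h x) (h y).
Proof. by move=> hh; rewrite /ijoin hh [X in interp B _ X](args2E _). Qed.
Lemma hom_imeet x y : hom h -> h (imeet x y) = imeet (h x) (h y).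
Proof. by move=> hh; rewrite /imeet hh [X in interp B _ X](args2E _). Qed.
Lemma hom_icompl x : hom h -> h (icompl x) = icompl (h x).
Proof. by move=> hh; rewrite /icompl hh. Qed.
Lemma hom_iint x : hom h -> h (iint x) = iint (h x).
Proof. by move=> hh; rewrite /iint hh. Qed.

Lemma hom_is_open x : hom h -> is_open x -> is_open (h x).
Proof. by move=> hh; rewrite /is_open -hom_iint // => ->. Qed.

Lemma is_ia_inj_hom :
  hom h -> (forall x y, h x = h y -> x = y) -> is_ia B -> is_ia A.
Proof.
move=> hh hi iaB.
by repeat split; intros; apply: hi;
  rewrite ?(hom_iint, hom_izero, hom_ione, hom_ijoin, hom_imeet, hom_icompl) //;
  rewrite ?(iint1, iintI, iint_le, iintK) //; ba iaB.
Qed.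

End HomLaws.

Lemma variety_inj_hom (V : alg IASig -> Prop) (A B : alg IASig) (h : A -> B) :
  ia_variety V -> hom h -> (forall x y, h x = h y -> x = y) -> V B -> V A.
Proof.
move=> [E VE] hh hi /VE[iaB satB]; apply/VE; split; first exact: is_ia_inj_hom iaB.
by move=> e /satB; apply: sat_inj_hom.
Qed.

(** * Star algebras and the Grzegorczyk law *)

(* Terms over different valuations are merged by interleaving their variables. *)
Lemma star_algP (B : alg IASig) :
  is_ia B -> star_alg B <-> forall b : B, gen (@is_open B) b.
Proof.
move=> iaB; split=> [sB b|gB b]; first by have [v [t [vo <-]]] := sB b; apply: gen_eval.
elim: (gB b) => {b} [b bo|o args _ /choice_fun[v /choice_fun[t vt]]].
  by exists (fun _ => b), (Var 0).
(* Numbers that code no variable go to [izero B], which keeps all values of [w] open. *)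
pose w k := if unpickle k is Some (i, n) then v i n else izero B.
exists w, (App o (fun i => tsubst (fun n => Var (pickle (i, n))) (t i))).
split=> [k|/=].
  rewrite /w; case: (unpickle k) => [[i n]|]; last exact: is_open_zero.
  by case: (vt i).
congr (interp B o _); apply: functional_extensionality => i; case: (vt i) => _ <-.
rewrite eval_tsubst /=; congr eval; apply: functional_extensionality => n.
by rewrite /w pickleK.
Qed.

Section Grz.
Variable B : alg IASig.
Hypotheses (iaB : is_ia B) (sB : star_alg B).
Implicit Types x y z u f : B.

(* Every element of a star algebra is constructible, hence locally constant
   somewhere on each nonzero element. *)
Lemma star_locally_constant x f : f <> izero B ->
  exists u, [/\ is_open u, imeet u f <> izero B &
    imeet u f <=i x \/ imeet (imeet u f) x = izero B].
Proof.
move: x f; suff P x : gen (@is_open B) x -> forall f, f <> izero B ->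
  exists u, [/\ is_open u, imeet u f <> izero B &
    imeet u f <=i x \/ imeet (imeet u f) x = izero B].
  by move=> x; apply: P; move: x; apply/star_algP.
(* The witness is [ione B] if [y] misses [f], and [y] itself otherwise. This also settles constants
   and interiors. *)
have opP y : is_open y -> forall f, f <> izero B ->
  exists u, [/\ is_open u, imeet u f <> izero B &
    imeet u f <=i y \/ imeet (imeet u f) y = izero B].
  move=> yo f f0; case: (classic (imeet y f = izero B)) => yf.
    exists (ione B); split; first exact: is_open_one.
      by move=> e; apply: f0; move: e; ba iaB.
    by right; move: yf; ba iaB.
  by exists y; split=> //; left; ba iaB.
elim=> {x} [x|[] /= args _ IH] //.
- exact: opP.
- by rewrite interpIA0; apply/opP/is_open_zero.
- by rewrite interpIA1; apply/opP/is_open_one.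
(* First [u] makes one argument constant on [imeet u f], then [w] makes the other constant on a
   nonzero part of that. *)
- rewrite interpIAjoin => f /(IH (@ord0 1))[u [uo uf ux]].
  have [w [wo wf wy]] := IH (@ord_max 1) _ uf; exists (imeet w u).
  split; first exact: is_open_meet.
    by move=> e; apply: wf; move: e; ba iaB.
  by case: ux => ux; case: wy => wy; [left|left|left|right]; move: ux wy; ba iaB.
- rewrite interpIAmeet => f /(IH (@ord0 1))[u [uo uf ux]].
  have [w [wo wf wy]] := IH (@ord_max 1) _ uf; exists (imeet w u).
  split; first exact: is_open_meet.
    by move=> e; apply: wf; move: e; ba iaB.
  by case: ux => ux; case: wy => wy; [left|right|right|right]; move: ux wy; ba iaB.
- rewrite interpIAcompl => f /(IH ord0)[u [uo uf ux]]; exists u; split=> //.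
  by case: ux => ux; [right|left]; move: ux; ba iaB.
- by rewrite interpIAint; apply/opP/is_open_int.
Qed.

(** With [w = x - c(c x - x)], the claim says that [z = x . g(-w)] vanishes. Otherwise [x] is
    constant on some nonzero [u . c z] with [u] open, and either constant value forces [u . z = 0],
    hence [u . c z = 0]. *)
Lemma star_grz x : x <=i icl (imeet x (icompl (icl (imeet (icl x) (icompl x))))).
Proof.
set w := imeet x (icompl _); pose z := imeet x (iint (icompl w)).
suff: z = izero B by rewrite /z /icl; ba iaB.
case: (classic (z = izero B)) => // z0; exfalso.
have cz0 : icl z <> izero B.
  by move=> e; apply: z0; move: e (le_icl iaB z); ba iaB.
have [u [uo ucz ux]] := star_locally_constant x cz0; apply: ucz.
(* If [x] misses [u . c z], then [u] misses [z], which lies below both [x] and [c z]. *)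
apply: open_disjoint_icl => //; case: ux => ux; last first.
  have : z <=i x by rewrite /z; ba iaB.
  by move: ux (le_icl iaB z); ba iaB.
(* Now [u . c z <= x], so [u'] misses [c x - x] and hence its closure. Thus [u' . x <= w], while
   [u' <= -w]; so [u' . x = u . z] is zero. *)
pose u' := imeet u (iint (icompl w)).
have u'o : is_open u' by apply: is_open_meet (is_open_int _ _).
have u'cx : imeet u' (icl x) <=i x.
  have := open_meet_icl iaB x (is_open_int iaB (icompl w)).
  rewrite [imeet _ x]imeetC // -/z; move: ux; rewrite /u'; ba iaB.
have : imeet u' (icl (imeet (icl x) (icompl x))) = izero B.
  by apply: open_disjoint_icl => //; move: u'cx; ba iaB.
by have := iint_le iaB (icompl w); rewrite /u' /z /w; ba iaB.
Qed.

End Grz.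

(** Term versions of the operations, since [vstar] needs the Grzegorczyk law as an equation between
    terms. *)
Definition tmeet (s t : term IASig nat) : term IASig nat :=
  @App IASig nat IAmeet (args2 s t).
Definition tcompl (t : term IASig nat) : term IASig nat :=
  @App IASig nat IAcompl (args1 t).
Definition tcl (t : term IASig nat) : term IASig nat :=
  tcompl (@App IASig nat IAint (args1 (tcompl t))).

Lemma eval_tmeet (A : alg IASig) (v : nat -> A) s t :
  eval v (tmeet s t) = imeet (eval v s) (eval v t).
Proof. exact: interpIAmeet. Qed.

Lemma eval_tcompl (A : alg IASig) (v : nat -> A) t :
  eval v (tcompl t) = icompl (eval v t).
Proof. by []. Qed.

Lemma eval_tcl (A : alg IASig) (v : nat -> A) t : eval v (tcl t) = icl (eval v t).
Proof. by []. Qed.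

Lemma star_variety_grz (V : alg IASig -> Prop) (A : alg IASig) (x : A) :
  ia_variety V -> star_variety V -> V A ->
  x <=i icl (imeet x (icompl (icl (imeet (icl x) (icompl x))))).
Proof.
move=> [E VE] sV /sV VA; pose t : term IASig nat := Var 0.
pose s := tmeet t (tcl (tmeet t (tcompl (tcl (tmeet (tcl t) (tcompl t)))))).
have evalE (B : alg IASig) (v : nat -> B) : eval v s = imeet (v 0)
    (icl (imeet (v 0) (icompl (icl (imeet (icl (v 0)) (icompl (v 0))))))).
  by rewrite !(eval_tmeet, eval_tcl, eval_tcompl).
have satA : sat A (s, t).
  by apply: VA => B /VE[iaB _] sB v; rewrite [LHS]evalE; apply: star_grz.
by have := satA (fun _ => x); rewrite [LHS]evalE.
Qed.

(** * Iterated residues in finite algebras *)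

Section FiniteGrz.
Variable B : alg IASig.
Hypothesis iaB : is_ia B.
Implicit Types x y : B.

Lemma gen_imeet x y : gen (@is_open B) x -> gen (@is_open B) y ->
  gen (@is_open B) (imeet x y).
Proof. by move=> gx gy; apply: gen_op => i; rewrite /args2; case: ifP. Qed.

Lemma gen_icompl x : gen (@is_open B) x -> gen (@is_open B) (icompl x).
Proof. by move=> gx; apply: gen_op. Qed.

Lemma gen_icl x : gen (@is_open B) (icl x).
Proof. by apply/gen_icompl/gen_in/is_open_int. Qed.

(** This is Hausdorff's residue of a subset of a topological space. *)
Definition residue x := imeet x (icl (imeet (icl x) (icompl x))).

Lemma residue_le x : residue x <=i x.
Proof. by rewrite /residue; ba iaB. Qed.

(** With [y = c x - x], one has [x = c x - y] and [y = c y - residue x], and closures are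
    complements of open elements. *)
Lemma gen_residue x : gen (@is_open B) (residue x) -> gen (@is_open B) x.
Proof.
move=> gd; pose y := imeet (icl x) (icompl x).
have yE : y = imeet (icl x) (icompl x) by [].
have yx : icl y <=i icl x.
  have : imeet (iint (icompl x)) (icl y) = izero B.
    by apply: open_disjoint_icl => //; [apply: is_open_int | rewrite /y /icl; ba iaB].
  by set c := icl y; rewrite /icl; ba iaB.
have -> : x = imeet (icl x) (icompl y) by move: yE (le_icl iaB x); ba iaB.
apply: gen_imeet; first exact: gen_icl; apply: gen_icompl.
have -> : y = imeet (icl y) (icompl (residue x)).
  by rewrite /residue -/y; move: yE yx (le_icl iaB y); ba iaB.
by apply: gen_imeet; [apply: gen_icl | apply: gen_icompl].
Qed.

Lemma finite_grz_star : finite_carrier B ->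
  (forall x, x <=i icl (imeet x (icompl (icl (imeet (icl x) (icompl x)))))) ->
  star_alg B.
Proof.
move=> [m [e eS]] grz; apply/star_algP => // x; have [idx idxK] := choice_fun eS.
have dec n k : iter (n + k) residue x <=i iter n residue x.
  elim: k => [|k]; first by rewrite addn0 imeetxx.
  by have := residue_le (iter (n + k) residue x); rewrite addnS /=; ba iaB.
(* By pigeonhole, two of the first [m + 1] iterates agree; as the sequence decreases, the earlier
   one is already a fixed point. *)
have [n fixn] : exists n, residue (iter n residue x) = iter n residue x.
  have [i [j [eij ij]]] : exists i j : 'I_m.+1,
      iter i residue x = iter j residue x /\ i <> j.
    apply: NNPP => no; suff /leq_card : injective (fun n : 'I_m.+1 =>
      idx (iter n residue x)) by rewrite !card_ord ltnn.
    move=> i j /(congr1 e); rewrite !idxK => eij.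
    by apply: NNPP => ij; apply: no; exists i, j.
  wlog lt_ij : i j eij ij / i < j.
    move=> wl; case: (ltngtP i j) => [|lt_ji|/val_inj //]; first exact: wl.
    by apply: (wl j i) => // ji; apply: ij.
  exists i; have := dec i.+1 (j - i.+1); have := dec i 1.
  by rewrite subnKC // -eij addn1 /=; ba iaB.
have {dec fixn} : gen (@is_open B) (iter n residue x).
  apply: gen_in; suff -> : iter n residue x = izero B by apply: is_open_zero.
  (* A fixed point satisfies [y <= c(c y - y)], so the law reads [y <= c 0 = 0]. *)
  move: fixn (grz (iter n residue x)); set y := iter n _ _.
  rewrite {1}/residue => fixn.
  have -> : imeet y (icompl (icl (imeet (icl y) (icompl y)))) = izero B.
    by move: fixn; ba iaB.
  rewrite /icl; have -> : icompl (izero B) = ione B by ba iaB.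
  by rewrite iint1 //; ba iaB.
by elim: n => //= n IHn /gen_residue.
Qed.

End FiniteGrz.

(** * Extending Heyting homomorphisms to star algebras *)

Section OpenAlgebra.
Variable B : alg IASig.
Hypothesis iaB : is_ia B.

Lemma is_open_op (o : h_op) (args : 'I_(h_arity o) -> B) :
  (forall i, is_open (args i)) -> is_open (open_op args).
Proof.
case: o args => args h /=.
- exact: is_open_zero.
- exact: is_open_one.
- exact: is_open_meet.
- exact: is_open_join.
- exact: is_open_int.
Qed.

Definition open_alg : alg HSig :=
  @Alg HSig {b : B | is_open b} (fun o args =>
    exist _ (@open_op B o (fun i => sval (args i)))
      (is_open_op (fun i => proj2_sig (args i)))).

End OpenAlgebra.

Definition open_mor (H : alg HSig) (B : alg IASig) (f : H -> B) : Prop :=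
  forall (o : h_op) (args : 'I_(h_arity o) -> H),
    f (interp H o args) = @open_op B o (fun i => f (args i)).

(** The content of [iso_open] with the isomorphism as a parameter, so that several statements can
    share it. *)
Definition open_iso (H : alg HSig) (B : alg IASig) (phi : H -> B) : Prop :=
  (forall x y, phi x = phi y -> x = y) /\
  (forall b : B, is_open b <-> exists x, phi x = b) /\ open_mor phi.

Lemma open_iso_alg (B : alg IASig) (iaB : is_ia B) :
  @open_iso (open_alg iaB) B (fun x => sval x).
Proof.
split; last split=> //.
  case=> [x hx] [y hy] /= e; case: y / e hy => hy.
  by rewrite (proof_irrelevance _ hx hy).
by move=> b; split=> [bo|[[x xo] /= <-//]]; exists (exist _ b bo).
Qed.

Section NormalForms.
Variable H : alg HSig.

Let h0 : H := interp H H0 (@args0 H).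
Let h1 : H := interp H H1 (@args0 H).
Let hmeet (a b : H) : H := interp H Hmeet (args2 a b).
Let hjoin (a b : H) : H := interp H Hjoin (args2 a b).
Let himp (a b : H) : H := interp H Himp (args2 a b).

(* Conjunctive normal forms: the pair (a, b) stands for the clause -a + b. *)
Fixpoint nf (B : alg IASig) (f : H -> B) (l : seq (H * H)) : B :=
  if l is p :: l' then imeet (ijoin (icompl (f p.1)) (f p.2)) (nf f l')
  else ione B.

Definition clause_join (p : H * H) (l : seq (H * H)) :=
  [seq (hmeet p.1 q.1, hjoin p.2 q.2) | q <- l].

Fixpoint nf_join (l l' : seq (H * H)) :=
  if l is p :: l1 then clause_join p l' ++ nf_join l1 l' else [::].

(** The complement of [-a + b] is [a . -b], given by the clauses [(1, a)] and [(b, 0)]; that of the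
    empty product is [(1, 0)]. *)
Fixpoint nf_compl (l : seq (H * H)) :=
  if l is p :: l' then nf_join [:: (h1, p.1); (p.2, h0)] (nf_compl l')
  else [:: (h1, h0)].

(** Interior commutes with meets and turns [-a + b] into [a => b], so the interior of a normal form
    is named by an element of [H]. *)
Fixpoint nf_int (l : seq (H * H)) : H :=
  if l is p :: l' then hmeet (himp p.1 p.2) (nf_int l') else h1.

Section Eval.
Variables (B : alg IASig) (f : H -> B).
Hypotheses (iaB : is_ia B) (fm : open_mor f).

Let f0 : f h0 = izero B. Proof. exact: fm. Qed.
Let f1 : f h1 = ione B. Proof. exact: fm. Qed.
Let fmeet a b : f (hmeet a b) = imeet (f a) (f b). Proof. exact: fm. Qed.
Let fjoin a b : f (hjoin a b) = ijoin (f a) (f b). Proof. exact: fm. Qed.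
Let fimp a b : f (himp a b) = iint (ijoin (icompl (f a)) (f b)). Proof. exact: fm. Qed.

Lemma nf_cat l l' : nf f (l ++ l') = imeet (nf f l) (nf f l').
Proof. by elim: l => [|p l /= ->] /=; ba iaB. Qed.

Lemma nf_joinE l l' : nf f (nf_join l l') = ijoin (nf f l) (nf f l').
Proof.
have clE p : nf f (clause_join p l') =
    ijoin (ijoin (icompl (f p.1)) (f p.2)) (nf f l').
  by elim: l' => [|q l' /= ->] /=; rewrite ?fmeet ?fjoin; ba iaB.
elim: l => [|p l IH] /=; first by ba iaB.
by rewrite nf_cat clE IH; ba iaB.
Qed.

Lemma nf_complE l : nf f (nf_compl l) = icompl (nf f l).
Proof.
elim: l => [|p l IH]; first by rewrite /= f0 f1; ba iaB.
have -> : nf_compl (p :: l) = nf_join [:: (h1, p.1); (p.2, h0)] (nf_compl l) by [].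
by rewrite nf_joinE IH /= f0 f1; ba iaB.
Qed.

Lemma nf_intE l : f (nf_int l) = iint (nf f l).
Proof. by elim: l => [|p l IH] /=; rewrite ?f1 ?iint1 // fmeet fimp IH iintI. Qed.

Lemma nf_open x : nf f [:: (h1, x)] = f x.
Proof. by rewrite /= f1; ba iaB. Qed.

End Eval.

Variables (B C : alg IASig) (phi : H -> B) (f : H -> C).
Hypotheses (iaB : is_ia B) (iaC : is_ia C).
Hypotheses (phiI : open_iso phi) (fm : open_mor f).

Let phim : open_mor phi. Proof. by case: phiI => _ []. Qed.

(** A clause [-a + b] is the unit iff [a . b = a]; injectivity of [phi] brings this equation to [H],
    and [f] carries it to [C]. *)
Lemma nf_eq1 l : nf phi l = ione B -> nf f l = ione C.
Proof.
elim: l => //= -[a b] l IH /= e.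
have ab : hmeet a b = a.
  case: phiI => inj _; apply: inj.
  have -> : phi (hmeet a b) = imeet (phi a) (phi b) by apply: phim.
  by move: e; ba iaB.
rewrite IH; last by move: e; ba iaB.
have : f (hmeet a b) = imeet (f a) (f b) by apply: fm.
by rewrite ab; ba iaC.
Qed.

(** Equality amounts to two implications, each a normal form equal to the unit. Hence the extension
    of [f] will be well defined. *)
Lemma nf_eq l l' : nf phi l = nf phi l' -> nf f l = nf f l'.
Proof.
move=> e.
have /nf_eq1 : nf phi (nf_join (nf_compl l) l') = ione B.
  by rewrite nf_joinE // nf_complE // e; ba iaB.
have /nf_eq1 : nf phi (nf_join (nf_compl l') l) = ione B.
  by rewrite nf_joinE // nf_complE // e; ba iaB.
by rewrite !nf_joinE // !nf_complE //; ba iaC.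
Qed.

Lemma nf_surj b : gen (@is_open B) b -> exists l, nf phi l = b.
Proof.
case: phiI => _ [phiS _].
have opP (c : B) : is_open c -> exists l, nf phi l = c.
  by move=> /phiS[x <-]; exists [:: (h1, x)]; rewrite nf_open.
elim=> {b} [b /opP //|[] /= args _ IH].
- by rewrite interpIA0; apply/opP/is_open_zero.
- by rewrite interpIA1; apply/opP/is_open_one.
- rewrite interpIAjoin; have [l <-] := IH (@ord0 1); have [l' <-] := IH (@ord_max 1).
  by exists (nf_join l l'); rewrite nf_joinE.
- rewrite interpIAmeet; have [l <-] := IH (@ord0 1); have [l' <-] := IH (@ord_max 1).
  by exists (l ++ l'); rewrite nf_cat.
- rewrite interpIAcompl; have [l <-] := IH ord0.
  by exists (nf_compl l); rewrite nf_complE.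
- by rewrite interpIAint; apply/opP/is_open_int.
Qed.

(** [F b] is the value under [f] of any normal form of [b]; the operations on normal forms commute
    with evaluation under [phi] and under [f]. *)
Lemma star_extension :
  star_alg B -> exists F : B -> C, hom F /\ forall x, F (phi x) = f x.
Proof.
move=> /(star_algP iaB) gB.
have [L LK] := choice_fun (fun b => nf_surj (gB b)).
have FE b l : nf phi l = b -> nf f (L b) = nf f l by move=> <-; apply: nf_eq.
exists (fun b => nf f (L b)); split; last first.
  by move=> x; rewrite (FE _ [:: (h1, x)]) ?nf_open.
case=> args; rewrite ?(interpIA0, interpIA1, interpIAjoin, interpIAmeet,
  interpIAcompl, interpIAint).
- rewrite (FE _ [:: (h1, h0)]) ?nf_open //; exact: fm || exact: phim.
- by rewrite (FE _ [::]).
- by rewrite -nf_joinE //; apply: FE; rewrite nf_joinE // !LK.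
- by rewrite -nf_cat //; apply: FE; rewrite nf_cat // !LK.
- by rewrite -nf_complE //; apply: FE; rewrite nf_complE // !LK.
- rewrite -nf_intE // -nf_open //; apply: FE.
  by rewrite nf_open // nf_intE // LK.
Qed.

End NormalForms.

(** * The functor of open elements on star algebras *)

Lemma hom_open_op (B C : alg IASig) (F : B -> C) o (args : 'I_(h_arity o) -> B) :
  hom F -> F (open_op args) = open_op (fun i => F (args i)).
Proof.
move=> Fh; case: o args => args /=.
- exact: hom_izero.
- exact: hom_ione.
- exact: hom_imeet.
- exact: hom_ijoin.
- by rewrite hom_iint // hom_ijoin // hom_icompl.
Qed.

Lemma gen_open_op (B : alg IASig) (P : B -> Prop) o (args : 'I_(h_arity o) -> B) :
  (forall i, gen P (args i)) -> gen P (open_op args).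
Proof.
have gop (o' : ia_op) args' := @gen_op IASig B P o' args'.
have g2 (x y : B) : gen P x -> gen P y -> forall i, gen P (args2 x y i).
  by move=> gx gy i; rewrite /args2; case: ifP.
case: o args => /= args gargs.
- by apply: gop; case.
- by apply: gop; case.
- by apply: gop; apply: g2.
- by apply: gop; apply: g2.
- by apply: (gop) => i; apply: (gop); apply: g2 => //; apply: gop => j; apply: gargs.
Qed.

Lemma open_mor_comp (H K : alg HSig) (B : alg IASig) (p : H -> K) (psi : K -> B) :
  hom p -> open_mor psi -> open_mor (psi \o p).
Proof. by move=> ph psim o args; rewrite /= ph; apply: psim. Qed.

(** Homomorphisms preserve openness, so [F] maps the range of [phi] into that of [psi]. *)
Lemma hom_restriction (H K : alg HSig) (B C : alg IASig)
    (phi : H -> B) (psi : K -> C) (F : B -> C) :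
  open_iso phi -> open_iso psi -> hom F ->
  exists p : H -> K, hom p /\ forall x, psi (p x) = F (phi x).
Proof.
move=> [_ [phiS phim]] [psiI [psiS psim]] Fh.
have /choice_fun[p pE] : forall x, exists y, psi y = F (phi x).
  by move=> x; apply/psiS/hom_is_open => //; apply/phiS; exists x.
exists p; split=> // o args; apply: psiI; rewrite pE phim hom_open_op // psim.
by congr open_op; apply: functional_extensionality.
Qed.

Lemma star_hom_eq (H : alg HSig) (B C : alg IASig) (phi : H -> B) (F G : B -> C) :
  is_ia B -> star_alg B -> open_iso phi -> hom F -> hom G ->
  (forall x, F (phi x) = G (phi x)) -> forall b, F b = G b.
Proof.
move=> iaB /(star_algP iaB) gB [_ [phiS _]] Fh Gh FG b.
by apply: gen_eq_hom (gB b) => // c /phiS[x <-].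
Qed.

Lemma finite_ia_op : finite_type (op IASig).
Proof.
exists 6, (fun i => nth IA0 [:: IA0; IA1; IAjoin; IAmeet; IAcompl; IAint] i).
by case; [exists (inord 0)|exists (inord 1)|exists (inord 2)|exists (inord 3)
  |exists (inord 4)|exists (inord 5)]; rewrite inordK.
Qed.

Lemma finite_h_op : finite_type (op HSig).
Proof.
exists 5, (fun i => nth H0 [:: H0; H1; Hmeet; Hjoin; Himp] i).
by case; [exists (inord 0)|exists (inord 1)|exists (inord 2)|exists (inord 3)
  |exists (inord 4)]; rewrite inordK.
Qed.

Section Variety.
Variable V : alg IASig -> Prop.
Hypotheses (varV : ia_variety V) (lfV : locally_finite V) (starV : star_variety V).

Lemma variety_is_ia A : V A -> is_ia A.
Proof. by case: varV => E VE /VE[]. Qed.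

Lemma finite_star A : V A -> finite_carrier A -> star_alg A.
Proof.
move=> VA fA; apply: finite_grz_star => //; first exact: variety_is_ia.
by move=> x; apply: star_variety_grz VA.
Qed.

(** The subalgebra generated by the open elements of [B] is a star algebra with the same open
    elements. *)
Lemma gamma_star H : gamma V H ->
  exists (B : alg IASig) (phi : H -> B), [/\ V B, star_alg B & open_iso phi].
Proof.
move=> [B [VB [phi [phiI [phiS phim]]]]]; pose B' := gen_alg (@is_open B).
have VB' : V B' by apply: variety_inj_hom VB => //; [exact: hom_gen_val|exact: gen_alg_inj].
have openE (b : B') : is_open b <-> is_open (sval b).
  split=> [bo|bo]; first exact: hom_is_open (@hom_gen_val _ _ _) bo.
  by apply: gen_alg_inj; rewrite hom_iint.
have phio x : is_open (phi x) by apply/phiS; exists x.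
exists B', (fun x => exist _ (phi x) (gen_in (phio x))); split=> //.
  apply/star_algP => [|b]; first exact: variety_is_ia.
  by elim: (gen_alg_gen b) => [c /openE|o args _]; [apply: gen_in|apply: gen_op].
split; last split.
- by move=> x y [] /phiI.
- move=> b; rewrite openE phiS; split=> -[x xE]; exists x; last by rewrite -xE.
  exact: gen_alg_inj.
- move=> o args; apply: gen_alg_inj; rewrite /= phim.
  by rewrite [RHS](hom_open_op _ (@hom_gen_val _ _ _)).
Qed.

(** Pairs of objects that correspond under the equivalence of finite algebras. *)
Definition linked (A : alg IASig) (H : alg HSig) (phi : H -> A) :=
  [/\ V A, finite_carrier A, star_alg A & open_iso phi].

Lemma linked_of_fin_pres A : fin_pres V A ->
  exists (H : alg HSig) (phi : H -> A), linked phi.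
Proof.
move=> [VA [n [a [_ [_ [ga _]]]]]]; have fA := lfV VA ga.
exists (open_alg (variety_is_ia VA)), (fun x => sval x); split=> //.
  exact: finite_star.
exact: open_iso_alg.
Qed.

(** The images under [phi] of generators of [H] generate all open elements, hence the star algebra
    [A], which is then finite. *)
Lemma linked_of_gamma_fin_pres H : fin_pres (gamma V) H ->
  exists (A : alg IASig) (phi : H -> A), linked phi.
Proof.
move=> [/gamma_star[A [phi [VA sA phiI]]] [n [a [_ [_ [ga _]]]]]].
exists A, phi; split=> //; apply: (lfV VA (a := phi \o a)) => x.
have iaA := variety_is_ia VA; have := (star_algP iaA).1 sA x.
case: phiI => _ [phiS phim]; apply: eval_gen => _ /phiS[y <-].
have [t <-] := ga y; suff: gen (fun c => exists i, c = phi (a i)) (phi (eval a t)).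
  by apply: eval_gen => _ [i ->]; exists (Var i).
elim: t => [i|o ts IH] /=; first by apply: gen_in; exists i.
by rewrite phim; apply: gen_open_op.
Qed.

Section Linked.
Variables (A : alg IASig) (H : alg HSig) (phi : H -> A).
Hypothesis lAH : linked phi.

Lemma linked_gamma : gamma V H.
Proof. by case: lAH => VA _ _ phiI; exists A; split=> //; exists phi. Qed.

Lemma linked_fin_pres : fin_pres V A.
Proof. by case: lAH => VA fA _ _; apply: finite_fin_pres finite_ia_op _ _ VA fA. Qed.

Lemma linked_gamma_fin_pres : fin_pres (gamma V) H.
Proof.
apply: finite_fin_pres finite_h_op _ _ linked_gamma _.
case: lAH => _ [m [e eS]] _ [phiI _].
exact: finite_carrier_inj phiI eS (interp H H0 (@args0 H)).
Qed.

(** The lifting problem extends to star algebras in [V], is solved there, and the solution restricts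
    to open elements. *)
Lemma linked_gamma_projective : projective V A -> projective (gamma V) H.
Proof.
case: lAH => VA _ sA phiO [_ prA]; split; first exact: linked_gamma.
move=> C D /gamma_star[E [psi [VE sE psiO]]] /gamma_star[G [chi [VG sG chiO]]].
move=> p ph pS f fh.
have [[iaA iaE] iaG] := (variety_is_ia VA, variety_is_ia VE, variety_is_ia VG).
have [P [Ph PE]] : exists P : E -> G, hom P /\ forall x, P (psi x) = chi (p x).
  apply: (star_extension (f := chi \o p)) psiO _ sE => //.
  by apply: open_mor_comp ph _; case: chiO => _ [].
have [F [Fh FE]] : exists F : A -> G, hom F /\ forall x, F (phi x) = chi (f x).
  apply: (star_extension (f := chi \o f)) phiO _ sA => //.
  by apply: open_mor_comp fh _; case: chiO => _ [].
(* The range of [P] is a subalgebra containing the open elements, since [p] is onto, and these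
   generate [G]. *)
have PS y : exists x, P x = y.
  have := (star_algP iaG).1 sG y; case: (chiO) => _ [chiS _].
  elim=> {y} [y /chiS[d <-]|o args _ /choice_fun[xs xsE]].
    by have [c <-] := pS d; exists (psi c); rewrite PE.
  exists (interp E o xs); rewrite Ph; congr (interp G o _).
  exact: functional_extensionality.
have [Q [Qh QE]] := prA _ _ VE VG P Ph PS F Fh.
have [q [qh qE]] := hom_restriction phiO psiO Qh.
exists q; split=> // x; case: (chiO) => inj _; apply: inj.
by rewrite -PE qE QE FE.
Qed.

(** The problem is restricted to open elements and the solution extended from [H] to [A]; extensions
    from a star algebra are unique, so the triangle commutes. *)
Lemma linked_projective : projective (gamma V) H -> projective V A.
Proof.
case: lAH => VA _ sA phiO [_ prH]; split=> // C D VC VD p ph pS f fh.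
have [[iaA iaC] iaD] := (variety_is_ia VA, variety_is_ia VC, variety_is_ia VD).
have [psiO chiO] := (open_iso_alg iaC, open_iso_alg iaD).
have [p' [p'h p'E]] := hom_restriction psiO chiO ph.
have [f' [f'h f'E]] := hom_restriction phiO chiO fh.
have gC : gamma V (open_alg iaC) by exists C; split=> //; eexists; exact: psiO.
have gD : gamma V (open_alg iaD) by exists D; split=> //; eexists; exact: chiO.
have p'S y : exists x, p' x = y.
  (* The interior of a preimage of an open element is an open preimage. *)
  have [c cE] := pS (sval y); exists (exist _ (iint c) (is_open_int iaC c)).
  case: chiO => inj _; apply: inj; rewrite p'E /= hom_iint // cE.
  exact: (proj2_sig y).
have [q [qh qE]] := prH _ _ gC gD p' p'h p'S f' f'h.
have [Q [Qh QE]] : exists Q : A -> C, hom Q /\ forall x, Q (phi x) = sval (q x).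
  apply: (star_extension (f := (fun x => sval x) \o q)) phiO _ sA => //.
  by apply: open_mor_comp qh _; case: psiO => _ [].
exists Q; split=> //; apply: (star_hom_eq iaA sA phiO) => //.
  exact: hom_comp Qh ph.
by move=> x; rewrite /= QE -f'E -qE p'E.
Qed.

(** A relation and not a map, because the algebra of open elements matters only up to
    isomorphism. *)
Definition unifier_link (u : unifier V A) (w : unifier (gamma V) H) : Prop :=
  exists psi : ucod w -> ucod u,
    open_iso psi /\ forall x, psi (umap w x) = umap u (phi x).

End Linked.

Section LinkedUnifiers.
Variables (A : alg IASig) (H : alg HSig) (phi : H -> A).
Hypothesis lAH : linked phi.

Lemma unifier_link_total (u : unifier V A) : exists w, unifier_link phi u w.
Proof.
case: u => B F Fh fpB prB; have [K [psi lBK]] := linked_of_fin_pres fpB.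
case: (lAH) (lBK) => _ _ _ phiO [_ _ _ psiO].
have [f [fh fE]] := hom_restriction phiO psiO Fh.
exists (Unifier fh (linked_gamma_fin_pres lBK) (linked_gamma_projective lBK prB)).
by exists psi; split.
Qed.

Lemma unifier_link_onto (w : unifier (gamma V) H) : exists u, unifier_link phi u w.
Proof.
case: w => K f fh fpK prK; have [B [psi lBK]] := linked_of_gamma_fin_pres fpK.
case: (lAH) (lBK) => VA _ sA phiO [VB _ _ psiO].
have [F [Fh FE]] : exists F : A -> B, hom F /\ forall x, F (phi x) = psi (f x).
  apply: (star_extension (f := psi \o f)) phiO _ sA; try exact: variety_is_ia.
  by apply: open_mor_comp fh _; case: psiO => _ [].
exists (Unifier Fh (linked_fin_pres lBK) (linked_projective lBK prK)).
by exists psi; split.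
Qed.

(** Comparison maps restrict to open elements in one direction and extend from them in the other. *)
Lemma unifier_link_more_general u w u' w' :
  unifier_link phi u w -> unifier_link phi u' w' ->
  more_general u u' <-> more_general w w'.
Proof.
case: (lAH) => VA _ sA phiO [psi [psiO psiE]] [psi' [psiO' psiE']].
have [VB _] := ufp u; have [VB' _] := ufp u'.
have [iaB iaB'] := (variety_is_ia VB, variety_is_ia VB').
have sB : star_alg (ucod u).
  by have [K [chi [_ _ sB _]]] := linked_of_fin_pres (ufp u).
split=> [[F [Fh FE]]|[f [fh fE]]].
  have [f [fh fE]] := hom_restriction psiO psiO' Fh; exists f; split=> // x.
  by case: psiO' => inj _; apply: inj; rewrite fE psiE psiE' FE.
have [F [Fh FE]] : exists F : ucod u -> ucod u',
    hom F /\ forall x, F (psi x) = psi' (f x).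
  apply: (star_extension (f := psi' \o f)) psiO _ sB => //.
  by apply: open_mor_comp fh _; case: psiO' => _ [].
exists F; split=> //; apply: (star_hom_eq (variety_is_ia VA) sA phiO).
- exact: uhom.
- exact: hom_comp (uhom u) Fh.
- by move=> x; rewrite /= -psiE FE -fE psiE'.
Qed.

End LinkedUnifiers.
End Variety.

(** * Transfer of unification types *)

Section Transfer.
Variables (S S' : sig) (K : alg S -> Prop) (K' : alg S' -> Prop).

(** The index type stays the same, so the cardinality of a mu-set is transferred with it. *)
Definition mu_le (A : alg S) (A' : alg S') : Prop :=
  forall I : Type, (exists f : I -> unifier K A, mu_set f) ->
    exists f : I -> unifier K' A', mu_set f.

(** Reflection of the quasiorder gives the antichain; preservation and surjectivity of [R] give
    density. *)
Lemma mu_le_link (A : alg S) (A' : alg S') (R : unifier K A -> unifier K' A' -> Prop) :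
  (forall u, exists w, R u w) -> (forall w, exists u, R u w) ->
  (forall u w u' w', R u w -> R u' w' -> more_general u u' <-> more_general w w') ->
  mu_le A A'.
Proof.
move=> Rl Rr Rle I [f [f_anti f_dense]].
have [f' f'P] := choice_fun (fun i => Rl (f i)); exists f'; split=> [i j|v].
  by move/(Rle _ _ _ _ (f'P i) (f'P j)); apply: f_anti.
have [u uv] := Rr v; have [i fu] := f_dense u; exists i.
exact/(Rle _ _ _ _ (f'P i) uv).
Qed.

End Transfer.

Definition unif_similar (S S' : sig) (K : alg S -> Prop) (K' : alg S' -> Prop)
    (A : alg S) (A' : alg S') : Prop :=
  [/\ unifiable K A <-> unifiable K' A', mu_le K K' A A' & mu_le K' K A' A].

Lemma unif_similar_sym (S S' : sig) (K : alg S -> Prop) (K' : alg S' -> Prop) A A' :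
  unif_similar K K' A A' -> unif_similar K' K A' A.
Proof. by case=> uE ml mr; split=> //; apply: iff_sym. Qed.

Lemma unif_similar_types (S S' : sig) (K : alg S -> Prop) (K' : alg S' -> Prop) A A' :
  unif_similar K K' A A' ->
  [/\ type1 K A -> type1 K' A', typeomega K A -> typeomega K' A',
      typeinf K A -> typeinf K' A' & type0 K A -> type0 K' A'].
Proof.
case=> _ ml mr; split.
- move=> [I [f [fm I1]]]; have [f' fm'] := ml I (ex_intro _ f fm).
  by exists I, f'.
- move=> [I [f [fm I1]]]; have [f' fm'] := ml I (ex_intro _ f fm).
  by exists I, f'.
- move=> [I [f [fm I1]]]; have [f' fm'] := ml I (ex_intro _ f fm).
  by exists I, f'.
- by move=> no [I [f fm]]; apply: no; exists I; apply: mr; exists f.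
Qed.

(** Universal clauses use a partner in [K] of an algebra of [K']; existential clauses move the
    witness from [K] to [K']. *)
Lemma var_type_transfer (S S' : sig) (K : alg S -> Prop) (K' : alg S' -> Prop) t :
  (forall A, fin_pres K A -> exists A', fin_pres K' A' /\ unif_similar K K' A A') ->
  (forall A', fin_pres K' A' -> exists A, fin_pres K A /\ unif_similar K K' A A') ->
  var_type K t -> var_type K' t.
Proof.
move=> KK' K'K.
have back A' : fin_pres K' A' /\ unifiable K' A' -> exists A,
    (fin_pres K A /\ unifiable K A) /\ unif_similar K K' A A'.
  move=> [/K'K[A [fpA sA]] uA']; exists A; split=> //; split=> //.
  by case: sA => uE _ _; apply/uE.
have forth A : fin_pres K A /\ unifiable K A -> exists A',
    (fin_pres K' A' /\ unifiable K' A') /\ unif_similar K K' A A'.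
  move=> [/KK'[A' [fpA' sA]] uA]; exists A'; split=> //; split=> //.
  by case: sA => uE _ _; apply/uE.
case: t => /=.
- move=> all1 A' /back[A [/all1 t1 /unif_similar_types[h _ _ _]]]; exact: h.
- move=> [all [A [/forth[A' [pA' /unif_similar_types[_ h _ _]]] /h tA']]].
  split; last by exists A'.
  move=> B' /back[B [/all tB /unif_similar_types[h1 h2 _ _]]].
  by case: tB => [/h1|/h2]; [left|right].
- move=> [all [A [/forth[A' [pA' /unif_similar_types[_ _ h _]]] /h tA']]].
  split; last by exists A'.
  move=> B' /back[B [/all tB /unif_similar_types[h1 h2 h3 _]]].
  by case: tB => [/h1|[/h2|/h3]]; [left|right; left|right; right].
- move=> [A [/forth[A' [pA' /unif_similar_types[_ _ _ h]]] /h tA']].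
  by exists A'.
Qed.

Lemma linked_similar (V : alg IASig -> Prop) :
  ia_variety V -> locally_finite V -> star_variety V ->
  forall (A : alg IASig) (H : alg HSig) (phi : H -> A),
  linked V phi -> unif_similar V (gamma V) A H.
Proof.
move=> varV lfV starV A H phi lAH.
have Rl := unifier_link_total varV lfV starV lAH.
have Rr := unifier_link_onto varV lfV lAH.
have Rle := unifier_link_more_general varV lfV starV lAH.
split.
- split=> [[u _]|[w _]]; first by have [w _] := Rl u; exists w.
  by have [u _] := Rr w; exists u.
- exact: mu_le_link Rl Rr Rle.
- apply: (mu_le_link (R := fun w u => unifier_link phi u w)) => // w u w' u' uw uw'.
  by apply: iff_sym; apply: Rle uw uw'.
Qed.

Theorem theorem5p13 (V : alg IASig -> Prop) :
  ia_variety V -> locally_finite V -> star_variety V ->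
  forall t : utype, var_type V t <-> var_type (gamma V) t.
Proof.
move=> varV lfV starV t.
have sim := linked_similar varV lfV starV.
have forth A : fin_pres V A ->
    exists H, fin_pres (gamma V) H /\ unif_similar V (gamma V) A H.
  move=> /(linked_of_fin_pres varV lfV starV)[H [phi lAH]]; exists H.
  by split; [exact: linked_gamma_fin_pres lAH | exact: sim lAH].
have back H : fin_pres (gamma V) H ->
    exists A, fin_pres V A /\ unif_similar V (gamma V) A H.
  move=> /(linked_of_gamma_fin_pres varV lfV)[A [phi lAH]]; exists A.
  by split; [exact: linked_fin_pres lAH | exact: sim lAH].
split; apply: var_type_transfer => //.
  by move=> H /back[A [fpA /unif_similar_sym sA]]; exists A.
by move=> A /forth[H [fpH /unif_similar_sym sA]]; exists H.
Qed.
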